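(* Let $(G,G^{+})$ be a simple dimension group with a specified order unit $e$, states being taken with respect to $e$. Suppose that $(G,G^{+})$ has exactly two extremal states $\sigma_{1},\sigma_{2}$, and that there are two elements $u^{1},u^{2}\in G$ such that $$\sigma_{1}(u^{1})=\sigma_{2}(u^{2})=1,\qquad \sigma_{1}(u^{2})=\sigma_{2}(u^{1})=0.$$ Define $\sigma:G\to\mathbb{R}^{2}$ by $\sigma(g)=(\sigma_{1}(g),\sigma_{2}(g))$ for $g\in G$. Then $$G^{+}=\{0\}\cup\sigma^{-1}\big((0,\infty)\times(0,\infty)\big),$$ $\mathbb{Z}^{2}\subseteq\sigma(G)$, and $\sigma(G)$ is dense in $\mathbb{R}^{2}$.
   Context: An ordered abelian group is a pair $(G,G^{+})$ with $G$ a (countable) abelian group and $G^{+}\subseteq G$ (the positive cone) satisfying $G^{+}+G^{+}\subseteq G^{+}$, $G^{+}-G^{+}=G$, $G^{+}\cap(-G^{+})=\{0\}$. A positive homomorphism $(G,G^+)\to(H,H^+)$ is a group homomorphism mapping $G^{+}$ into $H^{+}$. $\mathbb{Z}^{I}$ carries the simplicial order $\mathbb{Z}^{I+}=\{n : n(i)\ge 0 \text{ for all } i\}$. A dimension group is an ordered abelian group which is (isomorphic to) the inductive limit, in the category of ordered abelian groups, of a sequence $\mathbb{Z}^{I_1}\to\mathbb{Z}^{I_2}\to\cdots$ of simplicially ordered groups with connecting maps given by non-negative integer matrices; equivalently (Effros–Handelman–Shen), it is countable, unperforated and satisfies Riesz interpolation. An element $u\in G^{+}$ is an order unit if for every $a\in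 G$ there is a positive integer $k$ with $ku-a\in G^{+}$. A dimension group is simple if it has no order ideals other than $\{0\}$ and $G$; equivalently, every non-zero positive element is an order unit. A state with respect to an order unit $e$ is a positive homomorphism $\tau:(G,G^{+})\to(\mathbb{R},\mathbb{R}^{+})$, where $\mathbb{R}^+=[0,\infty)$, with $\tau(e)=1$. The states form a compact convex subset of $\mathbb{R}^{G}$; a state is extremal if it is an extreme point of this set. *)

(* Defs.v *)
From HB Require Import structures.
From mathcomp Require Import all_boot all_order all_algebra.
From mathcomp Require Import all_classical all_reals all_analysis.

Set Implicit Arguments.
Unset Strict Implicit.
Unset Printing Implicit Defensive.

Import Order.TTheory GRing.Theory Num.Theory.
Import numFieldNormedType.Exports.

Local Open Scope classical_set_scope.
Local Open Scope ring_scope.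

Record ordered_abelian_group (G : zmodType) (P : set G) : Prop := {
  oag_countable : countable [set: G];
  oag_add : forall x y, P x -> P y -> P (x + y);
  oag_gen : forall g, exists x y, [/\ P x, P y & g = x - y];
  oag_salient : P `&` [set x | P (- x)] = [set 0]
}.

Definition positive_hom (G H : zmodType) (P : set G) (Q : set H) (f : G -> H) :
    Prop :=
  GRing.zmod_morphism f /\ f @` P `<=` Q.

Definition simplicial_cone (n : nat) : set 'cV[int]_n :=
  [set v | forall i, 0 <= v i 0].

Section InductiveLimit.

(* The sequence Z^(d 0) -> Z^(d 1) -> ..., with A n acting on columns. *)
Variables (d : nat -> nat) (A : forall n, 'M[int]_(d n.+1, d n)).

Definition simplicial_cocone (H : zmodType) (Q : set H)
    (psi : forall n, 'cV[int]_(d n) -> H) : Prop :=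
  (forall n, positive_hom (@simplicial_cone (d n)) Q (psi n)) /\
  (forall n v, psi n.+1 (A n *m v) = psi n v).

(* The universal property in the category of ordered abelian groups; it
   determines (G, P) up to isomorphism only. *)
Definition is_inductive_limit (G : zmodType) (P : set G)
    (phi : forall n, 'cV[int]_(d n) -> G) : Prop :=
  [/\ ordered_abelian_group P,
      simplicial_cocone P phi &
      forall (H : zmodType) (Q : set H) (psi : forall n, 'cV[int]_(d n) -> H),
        ordered_abelian_group Q -> simplicial_cocone Q psi ->
        exists! f : G -> H,
          positive_hom P Q f /\ (forall n v, f (phi n v) = psi n v)].

End InductiveLimit.

Definition dimension_group (G : zmodType) (P : set G) : Prop :=
  exists (d : nat -> nat) (A : forall n, 'M[int]_(d n.+1, d n))
         (phi : forall n, 'cV[int]_(d n) -> G),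
    (forall n i j, 0 <= A n i j) /\ is_inductive_limit A P phi.

Definition order_unit (G : zmodType) (P : set G) (u : G) : Prop :=
  P u /\ forall a, exists k : nat, (0 < k)%N /\ P (u *+ k - a).

(* Order ideals are subgroups J with J = J^+ - J^+, where J^+ = J `&` P, such
   that 0 <= a <= b and b \in J imply a \in J. *)
Record order_ideal (G : zmodType) (P J : set G) : Prop := {
  oi_zero : J 0;
  oi_sub : forall x y, J x -> J y -> J (x - y);
  oi_gen : forall g, J g ->
    exists x y, [/\ (J `&` P) x, (J `&` P) y & g = x - y];
  oi_hereditary : forall a b, P a -> P (b - a) -> J b -> J a
}.

Definition simple_dimension_group (G : zmodType) (P : set G) : Prop :=
  dimension_group P /\
  forall J, order_ideal P J -> J = [set 0] \/ J = [set: G].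

Definition extreme_points (R : realType) (V : lmodType R) (K : set V) : set V :=
  [set x | K x /\ forall (y z : V) (t : R), K y -> K z -> 0 < t < 1 ->
     x = t *: y + (1 - t) *: z -> y = x /\ z = x].

Definition states (R : realType) (G : zmodType) (P : set G) (e : G) :
    set (G -> R^o) :=
  [set tau | positive_hom P [set x : R^o | 0 <= x] tau /\ tau e = 1].
Arguments states R {G} P e.

Definition extremal_states (R : realType) (G : zmodType) (P : set G) (e : G) :
    set (G -> R^o) :=
  extreme_points (states R P e).
Arguments extremal_states R {G} P e.

(* Main.v *)
Require Import Defs.
From HB Require Import structures.
From mathcomp Require Import all_boot all_order all_algebra.
From mathcomp Require Import all_classical all_reals all_analysis.
From mathcomp Require Import generic_quotient ring_quotient zify lra.

(* The universal property identifies [G] with the algebraic direct limit of the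
   groups Z^(d n), so [G] is unperforated and has Riesz interpolation.

   By simplicity every non-zero positive element is an order unit, hence strictly
   positive at every state. Conversely, let sup be the supremum of tau (- g) over
   the states tau. It is attained at an extremal state: the functional
   q x = inf { k / m | m x <= k e } is sublinear with q (- g) = sup, and making q
   linear successively at - g and at all elements of the countable group [G],
   each time with the largest possible value, produces a state which is extreme
   because it is a lexicographic maximum. So if sigma1 g and sigma2 g are
   positive then q (- g) < 0, some multiple of g is positive, and so is g.

   For density, interpolation applied to elements translated by large multiples
   of u1 and u2 treats the two coordinates independently: it gives elements of
   [G] in any box whose four sides have positions of the form sigma1 g1,
   sigma1 h1, sigma2 g2, sigma2 h2. The values of each sigma_i are dense in R
   because interpolation below v yields c with 0 < sigma_i c < sigma_i v, and one
   of c, v - c has at most half the value of v. *)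

Set Implicit Arguments.
Unset Strict Implicit.
Unset Printing Implicit Defensive.

Import Order.TTheory GRing.Theory Num.Theory.
Import numFieldNormedType.Exports.

Local Open Scope classical_set_scope.
Local Open Scope ring_scope.

(** * The algebraic direct limit of the groups Z^(d n) *)

Section AlgebraicLimit.
Local Open Scope quotient_scope.
Variables (d : nat -> nat) (A : forall n, 'M[int]_(d n.+1, d n)).
Hypothesis A_ge0 : forall n i j, 0 <= A n i j.

(* The inner polynomial [p`_n] encodes a vector placed at stage [n]; [stage p N]
   is the sum of the images at stage [N] of those placed at stages up to [N].
   The recursion avoids casts between the types ['cV_(d n)]. *)
Fixpoint stage (p : {poly {poly int}}) n : 'cV[int]_(d n) :=
  if n is k.+1 then A k *m stage p k + \col_i p`_k.+1`_i else \col_i p`_0`_i.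

Lemma stageB p q n : stage (p - q) n = stage p n - stage q n.
Proof.
elim: n => [|n IHn] /=; first by apply/colP => i; rewrite !mxE !coefB.
by rewrite IHn mulmxBr opprD addrACA; congr (_ + _); apply/colP => i;
  rewrite !mxE !coefB.
Qed.

Lemma stage0 n : stage 0 n = 0.
Proof. by rewrite -(subrr 0) stageB subrr. Qed.

Lemma stageN p n : stage (- p) n = - stage p n.
Proof. by rewrite -sub0r stageB stage0 sub0r. Qed.

Lemma stageD p q n : stage (p + q) n = stage p n + stage q n.
Proof. by rewrite -{1}(opprK q) stageB stageN opprK. Qed.

Definition lift_stage n (v : 'cV[int]_(d n)) : {poly {poly int}} :=
  (\sum_(i < d n) v i 0 *: 'X^i) *: 'X^n.

Lemma lift_stage_col n (v : 'cV[int]_(d n)) m :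
  \col_(i < d m) (lift_stage v)`_m`_i =
  if m == n then \col_i (\sum_(j < d n) v j 0 *: 'X^j)`_i
  else 0 :> 'cV[int]_(d m).
Proof.
by apply/colP => i; rewrite !mxE coefZ coefXn; case: eqP => _;
  rewrite !mxE ?mulr1// mulr0 coef0.
Qed.

Lemma stage_lift_lt n (v : 'cV[int]_(d n)) m : (m < n)%N ->
  stage (lift_stage v) m = 0.
Proof.
elim: m => [|m IHm] mn; rewrite [stage _ _]/= lift_stage_col (ltn_eqF mn)//.
by rewrite IHm ?mulmx0 ?addr0// ltnW.
Qed.

Lemma stage_lift n (v : 'cV[int]_(d n)) : stage (lift_stage v) n = v.
Proof.
have E : \col_(i < d n) (lift_stage v)`_n`_i = v.
  rewrite lift_stage_col eqxx; apply/colP => i; rewrite mxE coef_sum.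
  rewrite (bigD1 i)//= coefZ coefXn eqxx mulr1 big1 ?addr0// => j ji.
  by rewrite coefZ coefXn eq_sym (inj_eq val_inj) (negbTE ji) mulr0.
case: n v E => [|n] v E; rewrite [stage _ _]/= E//.
by rewrite stage_lift_lt// mulmx0 add0r.
Qed.

Lemma stage_lift_gt n (v : 'cV[int]_(d n)) m : (n <= m)%N ->
  stage (lift_stage v) m.+1 = A m *m stage (lift_stage v) m.
Proof.
by move=> nm; rewrite [LHS]/= lift_stage_col gtn_eqF ?addr0.
Qed.

Lemma stage_lift_step n (v : 'cV[int]_(d n)) m : (n < m)%N ->
  stage (lift_stage (A n *m v)) m = stage (lift_stage v) m.
Proof.
elim: m => // m IHm; rewrite ltnS leq_eqVlt => /predU1P[<-|nm].
  by rewrite stage_lift stage_lift_gt// stage_lift.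
by rewrite stage_lift_gt// IHm// stage_lift_gt// ltnW.
Qed.

(** From its size on, [p] places no further vector, so only the matrices act. *)
Lemma stage_size (p : {poly {poly int}}) m : (size p <= m.+1)%N -> stage p m.+1 = A m *m stage p m.
Proof.
move=> pm; rewrite [LHS]/=; set c := \col__ _; suff -> : c = 0 by rewrite addr0.
by apply/colP => i; rewrite !mxE (nth_default 0 pm) coef0.
Qed.

Lemma stage_ge0 m n (p : {poly {poly int}}) : (size p <= m.+1)%N ->
  (m <= n)%N -> (forall i, 0 <= stage p m i 0) -> forall i, 0 <= stage p n i 0.
Proof.
move=> pm /subnK <- h; elim: (n - m)%N => // k IHk.
rewrite -[(k.+1 + m)%N]/(k + m).+1 => i.
rewrite stage_size ?mxE ?sumr_ge0// => [j _|].
  by rewrite mulr_ge0// IHk.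
by rewrite (leq_trans pm)// ltnS leq_addl.
Qed.

Lemma size_lift_stage n (v : 'cV[int]_(d n)) : (size (lift_stage v) <= n.+1)%N.
Proof. by rewrite (leq_trans (size_scale_leq _ _))// size_polyXn. Qed.

(** The relations of the direct limit: an element dies when its images vanish from some stage on. *)
Definition null_pred : {pred {poly {poly int}}} :=
  fun p => `[< \forall N \near \oo, stage p N = 0 >].

Lemma null_predP p : (p \in null_pred) <-> \forall N \near \oo, stage p N = 0.
Proof. by split => [/asboolP|h]; [|apply/asboolP]. Qed.

Lemma null_zmod_closed : zmod_closed null_pred.
Proof.
split=> [|p q /null_predP hp /null_predP hq]; apply/null_predP; near=> N.
  exact: stage0.
by rewrite stageB (near hp N)// (near hq N)// subrr.
Unshelve. all: by end_near. Qed.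

HB.instance Definition _ :=
  GRing.isZmodClosed.Build {poly {poly int}} null_pred null_zmod_closed.

Definition alg_limit : zmodType := Quotient.quot null_pred.
Definition to_limit (p : {poly {poly int}}) : alg_limit := \pi_alg_limit p.

Lemma to_limitB : zmod_morphism to_limit.
Proof. exact: raddfB. Qed.

Lemma to_limitD p q : to_limit (p + q) = to_limit p + to_limit q.
Proof. exact: raddfD. Qed.

Lemma to_limitN p : to_limit (- p) = - to_limit p.
Proof. exact: raddfN. Qed.

Lemma to_limit0 : to_limit 0 = 0.
Proof. exact: raddf0. Qed.

Lemma to_limit_repr (x : alg_limit) : to_limit (repr x) = x.
Proof. exact: reprK. Qed.

Lemma to_limit_eqP p q :
  to_limit p = to_limit q <-> \forall N \near \oo, stage p N = stage q N.
Proof.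
transitivity (p - q \in null_pred).
  by rewrite Quotient.idealrBE; split => /eqP.
by rewrite null_predP; split; apply: filterS => N; rewrite stageB;
  [move/subr0_eq | move->; rewrite subrr].
Qed.

(** Stated for the chosen representative; [limit_coneP] gives the same condition for any other. *)
Definition limit_cone : set alg_limit :=
  [set x | (\forall N \near \oo, forall i, 0 <= stage (repr x) N i 0)].

Lemma limit_coneP p :
  limit_cone (to_limit p) <-> \forall N \near \oo, forall i, 0 <= stage p N i 0.
Proof.
have /to_limit_eqP E := to_limit_repr (to_limit p).
by split=> h; near=> N; [rewrite -(near E N)//|rewrite (near E N)//]; near: N.
Unshelve. all: by end_near. Qed.

Definition stage_map n (v : 'cV[int]_(d n)) : alg_limit := to_limit (lift_stage v).

Lemma stage_mapP n (v : 'cV[int]_(d n)) (p : {poly {poly int}}) :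
  (size p <= n.+1)%N -> stage p n = v -> stage_map v = to_limit p.
Proof.
move=> pn <-; apply/to_limit_eqP; exists n => // m /= /subnK <-.
elim: (m - n)%N => [|k IHk]; first by rewrite stage_lift.
rewrite -[(k.+1 + n)%N]/(k + n).+1 stage_lift_gt ?leq_addl// IHk stage_size//.
by rewrite (leq_trans pn)// ltnS leq_addl.
Qed.

Lemma stage_mapB n : zmod_morphism (@stage_map n).
Proof.
move=> v w; rewrite -to_limitB; apply: stage_mapP.
  by rewrite (leq_trans (size_polyD _ _))// size_polyN geq_max !size_lift_stage.
by rewrite stageB !stage_lift.
Qed.

Lemma stage_map_ge0 n v : simplicial_cone v -> limit_cone (@stage_map n v).
Proof.
move=> v0; apply/limit_coneP; exists n => // m /= nm.
by apply: (stage_ge0 _ nm); rewrite ?size_lift_stage// stage_lift.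
Qed.

Lemma stage_map_surj x : exists n (v : 'cV[int]_(d n)), x = stage_map v.
Proof.
exists (size (repr x)), (stage (repr x) (size (repr x))).
by rewrite -[LHS]to_limit_repr; apply/esym/stage_mapP.
Qed.

Lemma stage_map_cocone : simplicial_cocone A limit_cone stage_map.
Proof.
split=> [n|n v]; first split; first exact: stage_mapB.
  by move=> _ [v v0 <-]; exact: stage_map_ge0.
by apply/to_limit_eqP; exists n.+1 => // m nm; exact: stage_lift_step.
Qed.

(** This makes the algebraic limit an admissible target for the universal property. Generation comes
    from the positive and negative parts of a vector. *)
Lemma limit_ordered : ordered_abelian_group limit_cone.
Proof.
split.
- rewrite (_ : [set: alg_limit] = range to_limit).
    by apply: sub_countable (card_image_le _ _) _; exact: countableP.
  by apply/seteqP; split=> // x _; exists (repr x) => //; exact: to_limit_repr.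
- move=> x y; rewrite -(to_limit_repr x) -(to_limit_repr y) => /limit_coneP hx.
  move=> /limit_coneP hy; rewrite -to_limitD; apply/limit_coneP.
  near=> N => i; rewrite stageD mxE addr_ge0//.
    by move: i; near: N.
  by move: i; near: N.
- move=> x; have [n [v ->]] := stage_map_surj x.
  pose vp : 'cV[int]_(d n) := \col_i Num.max (v i 0) 0.
  pose vn : 'cV[int]_(d n) := \col_i Num.max (- v i 0) 0.
  exists (stage_map vp), (stage_map vn); split.
  + by apply: stage_map_ge0 => i; rewrite mxE le_max lexx orbT.
  + by apply: stage_map_ge0 => i; rewrite mxE le_max lexx orbT.
  + rewrite -stage_mapB; congr stage_map; apply/colP => i; rewrite !mxE.
    by case: (leP (v i 0) 0) => h; case: (leP (- v i 0) 0); lia.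
- apply/seteqP; split => x.
    rewrite /= -(to_limit_repr x) => -[/limit_coneP hx].
    rewrite -to_limitN => /limit_coneP hy.
    rewrite -to_limit0; apply/to_limit_eqP.
    near=> N; rewrite stage0; apply/colP => i; rewrite mxE.
    apply/eqP; rewrite eq_le; apply/andP; split; last first.
      by move: i; near: N.
    have : 0 <= stage (- repr x) N i 0 by move: i; near: N.
    by rewrite stageN mxE oppr_ge0.
  move=> ->; rewrite /= oppr0; suff : limit_cone 0 by [].
  rewrite -to_limit0; apply/limit_coneP.
  by near=> N => i; rewrite stage0 mxE.
Unshelve. all: by end_near. Qed.

End AlgebraicLimit.

(** * Unperforation and Riesz interpolation in a dimension group *)

(** [S x N] is the stage [N] of a representative of the image of [x] in the algebraic limit.
    Questions about finitely many elements of [G] thus reduce to coordinates of integer vectors at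
    one late stage. *)
Lemma dimension_group_stages (G : zmodType) (P : set G) : dimension_group P ->
  exists (d : nat -> nat) (phi : forall n, 'cV[int]_(d n) -> G)
         (S : G -> forall n, 'cV[int]_(d n)),
    [/\ forall n, positive_hom (@simplicial_cone (d n)) P (phi n),
        forall x, \forall N \near \oo, phi N (S x N) = x,
        forall x y, \forall N \near \oo, S (x - y) N = S x N - S y N &
        forall x, P x -> \forall N \near \oo, simplicial_cone (S x N)].
Proof.
move=> [d [A [phi [A0 [oP [phiP phiA] univ]]]]].
have [f [[[fB fP] fphi] _]] := univ _ _ _ (limit_ordered A0) (stage_map_cocone A0).
pose S x N := stage A (repr (f x)) N.
have SB x y : \forall N \near \oo, S (x - y) N = S x N - S y N.
  have /(@to_limit_eqP _ A) : to_limit A (repr (f (x - y))) =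
      to_limit A (repr (f x) - repr (f y)).
    by rewrite to_limitB !to_limit_repr fB.
  by apply: filterS => N; rewrite stageB.
have phiB n : zmod_morphism (phi n) by have [] := phiP n.
have SP x : P x -> \forall N \near \oo, simplicial_cone (S x N).
  by move=> Px; apply: (fP); exists x.
(* From stage [size p] on, the image in [G] no longer depends on the stage; this induces the map [h]
   from the limit back to [G]. *)
pose val (p : {poly {poly int}}) : G := phi (size p) (stage A p (size p)).
have valE p : \forall N \near \oo, phi N (stage A p N) = val p.
  exists (size p) => // m /= /subnK <-; elim: (m - _)%N => // k IHk.
  by rewrite -[(k.+1 + _)%N]/(k + _).+1 stage_size ?phiA// leqW// leq_addl.
pose h (x : alg_limit A) := val (repr x).
have hE p : \forall N \near \oo, phi N (stage A p N) = h (to_limit A p).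
  have /to_limit_eqP E := to_limit_repr (to_limit A p).
  near=> N; rewrite -(near E N)//; near: N; exact: valE.
have near_eq (x y : G) : (\forall N \near \oo, x = y) -> x = y.
  by move=> [N _ /(_ N (leqnn _))].
have hB : zmod_morphism h.
  move=> x y; apply: near_eq.
  have := hE (repr x - repr y); rewrite to_limitB !to_limit_repr => hD.
  have hX := hE (repr x); have hY := hE (repr y).
  rewrite !to_limit_repr in hX hY; near=> N.
  by rewrite -(near hD N)// -(near hX N)// -(near hY N)// stageB phiB.
(* Both maps factor the cocone [phi] through itself, so uniqueness identifies them. *)
have hf : h \o f = id.
  have [g [_ gU]] := univ _ _ _ oP (conj phiP phiA).
  rewrite -(gU (h \o f)) ?(gU id)//.
    by split=> //; split=> // _ [x Px <-].
  split=> [|n v /=]; first split.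
  - by move=> x y /=; rewrite fB hB.
  - move=> _ [x Px <-] /=; have := SP _ Px; have := valE (repr (f x)).
    rewrite -/(h (f x)) => E1 E2.
    suff : \forall N \near \oo, P (h (f x)) by move=> [N _ /(_ N (leqnn _))].
    near=> N; rewrite -(near E1 N)//; have [_] := phiP N; apply.
    by exists (S x N) => //; near: N.
  - rewrite fphi; apply: near_eq; have E := hE (lift_stage v).
    near=> N; rewrite /stage_map -(near E N)//.
    have : (n <= N)%N by near: N; exists n.
    move=> /subnK <-; elim: (N - n)%N => [|k IHk]; first by rewrite stage_lift.
    by rewrite -[(k.+1 + n)%N]/(k + n).+1 stage_lift_gt ?leq_addl// phiA.
exists d, phi, S; split=> // x; have := valE (repr (f x)).
by rewrite -/(h (f x)) -[h _]/((h \o f) x) hf.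
Unshelve. all: by end_near. Qed.

Section DimensionGroup.
Variables (G : zmodType) (P : set G).
Hypothesis dP : dimension_group P.

Lemma dimension_group_ordered : ordered_abelian_group P.
Proof. by have [d [A [phi [_ []]]]] := dP. Qed.

Lemma dimension_group_unperforated m x : P (x *+ m.+1) -> P x.
Proof.
have [d [phi [S [phiP phiS SB SP]]]] := dimension_group_stages dP.
have SM n : \forall N \near \oo, S (x *- n) N = S x N *- n.
  elim: n => [|n IHn].
    have := SB 0 0; rewrite subrr; apply: filterS => N.
    by rewrite subrr !mulr0n !oppr0.
  have := SB (x *- n) x; rewrite -opprD -mulrSr => h.
  by near=> N; rewrite (near h N)// (near IHn N)// mulrSr opprD.
(* [S] is only known to respect differences eventually, so the multiple is written as
   [0 - x *- m.+1]. *)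
move=> /SP Pmx; have hN := SB 0 (x *- m.+1); have h0 := SB 0 0.
rewrite subr0 in h0; rewrite sub0r opprK in hN; have hm := SM m.+1; have hx := phiS x.
suff : \forall N \near \oo, P x by move=> [N _ /(_ N (leqnn _))].
near=> N; rewrite -(near hx N)//; have [_] := phiP N; apply.
exists (S x N) => // i; have : simplicial_cone (S (x *+ m.+1) N) by near: N.
move/(_ i); rewrite (near hN N)// (near hm N)//.
have -> : S 0 N = 0 by apply/esym/eqP; rewrite -(subrr (S 0 N)) -(near h0 N).
by rewrite sub0r opprK mulmxnE pmulrn_lge0.
Unshelve. all: by end_near. Qed.

(** At a late stage the coordinatewise maximum of the two lower vectors interpolates. *)
Lemma dimension_group_riesz a1 a2 b1 b2 :
  P (b1 - a1) -> P (b2 - a1) -> P (b1 - a2) -> P (b2 - a2) ->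
  exists z, [/\ P (z - a1), P (z - a2), P (b1 - z) & P (b2 - z)].
Proof.
have [d [phi [S [phiP phiS SB SP]]]] := dimension_group_stages dP.
move=> /SP h11 /SP h21 /SP h12 /SP h22.
have e11 := SB b1 a1; have e21 := SB b2 a1; have e12 := SB b1 a2.
have e22 := SB b2 a2.
have ea1 := phiS a1; have ea2 := phiS a2; have eb1 := phiS b1; have eb2 := phiS b2.
suff : \forall N \near \oo, exists z,
    [/\ P (z - a1), P (z - a2), P (b1 - z) & P (b2 - z)].
  by move=> [N _ /(_ N (leqnn _))].
near=> N; pose z := \col_i Num.max (S a1 N i 0) (S a2 N i 0).
exists (phi N z).
have [phiB phi0] := phiP N.
have key (v w : 'cV[int]_(d N)) : (forall i, v i 0 <= w i 0) -> P (phi N w - phi N v).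
  by move=> vw; rewrite -phiB; apply: phi0; exists (w - v) => // i;
    rewrite !mxE subr_ge0.
have l11 i : S a1 N i 0 <= S b1 N i 0.
  have : simplicial_cone (S (b1 - a1) N) by near: N.
  by move/(_ i); rewrite (near e11 N)// !mxE subr_ge0.
have l21 i : S a1 N i 0 <= S b2 N i 0.
  have : simplicial_cone (S (b2 - a1) N) by near: N.
  by move/(_ i); rewrite (near e21 N)// !mxE subr_ge0.
have l12 i : S a2 N i 0 <= S b1 N i 0.
  have : simplicial_cone (S (b1 - a2) N) by near: N.
  by move/(_ i); rewrite (near e12 N)// !mxE subr_ge0.
have l22 i : S a2 N i 0 <= S b2 N i 0.
  have : simplicial_cone (S (b2 - a2) N) by near: N.
  by move/(_ i); rewrite (near e22 N)// !mxE subr_ge0.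
split.
- by rewrite -[a1 in X in P X](near ea1 N)//; apply: key => i; rewrite mxE le_max lexx.
- by rewrite -[a2 in X in P X](near ea2 N)//; apply: key => i; rewrite mxE le_max lexx orbT.
- by rewrite -[b1 in X in P X](near eb1 N)//; apply: key => i; rewrite mxE ge_max l11 l12.
- by rewrite -[b2 in X in P X](near eb2 N)//; apply: key => i; rewrite mxE ge_max l21 l22.
Unshelve. all: by end_near. Qed.

End DimensionGroup.

Lemma zmod_morphism_additive (U V : zmodType) (f : U -> V) :
  GRing.zmod_morphism f -> exists F : {additive U -> V}, f = F.
Proof.
move=> fB; pose F : {additive U -> V} :=
  HB.pack f (GRing.isZmodMorphism.Build U V f fB).
by exists F.
Qed.

(** * Sublinear functionals and extreme additive maps below them *)

Section Sublinear.
Variables (R : realType) (G : zmodType).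
Implicit Types (q : G -> R) (x y g : G).

(** Homogeneity is asked for natural multiples only, as [G] is just a group; the reverse inequality
    follows from subadditivity. *)
Definition sublinear q :=
  (forall x y, q (x + y) <= q x + q y) /\
  (forall x n, q x *+ n <= q (x *+ n)).

Section Basics.
Variable q : G -> R.
Hypothesis qP : sublinear q.

Lemma sublinear0 : q 0 = 0.
Proof.
have [qD qM] := qP; apply/eqP; rewrite eq_le.
have := qD 0 0; have := qM 0 2; rewrite addr0 mul0rn mulr2n; lra.
Qed.

Lemma sublinear_opp x : - q (- x) <= q x.
Proof. by rewrite -subr_ge0 opprK -sublinear0 -(subrr x); case: qP. Qed.

Lemma sublinear_mulrn x n : q (x *+ n) <= q x *+ n.
Proof.
elim: n => [|n IHn]; first by rewrite !mulr0n sublinear0.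
by rewrite !mulrS (le_trans (qP.1 _ _))// lerD2l.
Qed.

End Basics.

(* Forces linearity at [g]: the largest sublinear functional below [q] whose
   value at [- g] is at most [- q g]. *)
Definition bend g q x := inf [set q (x + g *+ t) - q g *+ t | t in [set: nat]].

Section Bend.
Variables (q : G -> R) (g : G).
Hypothesis qP : sublinear q.

Lemma bend_nonempty x : [set q (x + g *+ t) - q g *+ t | t in [set: nat]] !=set0.
Proof. by eexists; exists 0%N. Qed.

Lemma bend_lbound x :
  lbound [set q (x + g *+ t) - q g *+ t | t in [set: nat]] (- q (- x)).
Proof.
move=> _ [t _ <-]; have [qD qM] := qP.
have := qD (x + g *+ t) (- x); rewrite addrAC subrr add0r.
have := qM g t; lra.
Qed.

Lemma bend_le_at t x : bend g q x <= q (x + g *+ t) - q g *+ t.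
Proof.
by apply: ge_inf; [exists (- q (- x)); exact: bend_lbound | exists t].
Qed.

Lemma bend_le x : bend g q x <= q x.
Proof. by have := bend_le_at 0 x; rewrite !mulr0n addr0 subr0. Qed.

Lemma bend_opp : bend g q (- g) <= - q g.
Proof.
by have := bend_le_at 1 (- g); rewrite !mulr1n addNr (sublinear0 qP) sub0r.
Qed.

Lemma le_bend (c : R) x : (forall t, c <= q (x + g *+ t) - q g *+ t) -> c <= bend g q x.
Proof.
by move=> h; apply: lb_le_inf; [exact: bend_nonempty | move=> _ [t _ <-]].
Qed.

Lemma bend_sublinear : sublinear (bend g q).
Proof.
have [qD qM] := qP; split=> [x y|x n].
  rewrite -lerBlDr; refine (le_bend _) => t; rewrite lerBlDr -lerBlDl.
  refine (le_bend _) => s; rewrite lerBlDr.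
  apply: le_trans (bend_le_at (s + t) _) _.
  have := qD (x + g *+ t) (y + g *+ s).
  rewrite addrACA -mulrnDr [(t + s)%N]addnC mulrnDr; lra.
refine (le_bend _) => t; case: n => [|n].
  rewrite !mulr0n add0r subr_ge0; exact: qM.
have /le_trans := ler_wMn2r n.+1 (bend_le_at t x); apply.
rewrite mulrnBl; apply: le_trans (lerB (qM _ _) (lexx _)) _.
rewrite mulrnDl -!mulrnA.
(* Only [t] of the copies of [g] stay inside [q]; the other [t * n] are split off by subadditivity
   and cancel against multiples of [q g]. *)
have -> : (t * n.+1 = t + t * n)%N by rewrite mulnS.
rewrite !mulrnDr addrA.
have := qD (x *+ n.+1 + g *+ t) (g *+ (t * n)).
have := sublinear_mulrn qP g (t * n); lra.
Qed.

(** Shifting by [g *+ t] changes [a] by exactly [q g *+ t]. So an additive map touching [q] at [g]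
    stays below the bent functional. *)
Lemma le_bend_additive (a : {additive G -> R}) x :
  (forall y, a y <= q y) -> a g = q g -> a x <= bend g q x.
Proof.
by move=> aq ag; refine (le_bend _) => t; rewrite lerBrDr -ag -raddfMn -raddfD.
Qed.

End Bend.

(* The limit of the chain maximises [u 0], [u 1], ... lexicographically among
   the additive maps below [q]; this is what makes it extreme. *)
Section Chain.
Variables (q : G -> R) (u : nat -> G).
Hypotheses (qP : sublinear q) (u_surj : forall x, exists n, u n = x).

Fixpoint chain n : G -> R := if n is k.+1 then bend (u k) (chain k) else q.

Lemma chain_sublinear n : sublinear (chain n).
Proof. by elim: n => //= n IHn; exact: bend_sublinear. Qed.

Lemma chain_le m n x : (m <= n)%N -> chain n x <= chain m x.
Proof.
move=> /subnK <-; elim: (n - m)%N => // k; apply: le_trans.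
exact/bend_le/chain_sublinear.
Qed.

Definition chain_inf x := inf (range (chain ^~ x)).

Lemma chain_inf_le n x : chain_inf x <= chain n x.
Proof.
apply: ge_inf; last by exists n.
exists (- q (- x)) => _ [k _ <-]; apply: le_trans (sublinear_opp (chain_sublinear _) _).
by rewrite lerN2; exact: (@chain_le 0).
Qed.

Lemma le_chain_inf (c : R) x : (forall n, c <= chain n x) -> c <= chain_inf x.
Proof.
by move=> h; apply: lb_le_inf; [eexists; exists 0%N | move=> _ [k _ <-]].
Qed.

Lemma chain_infD x y : chain_inf (x + y) <= chain_inf x + chain_inf y.
Proof.
rewrite -lerBlDr; refine (le_chain_inf _) => n; rewrite lerBlDr -lerBlDl.
refine (le_chain_inf _) => m; rewrite lerBlDr.
apply: le_trans (chain_inf_le (maxn m n) _) _.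
apply: le_trans ((chain_sublinear _).1 _ _) _.
by rewrite addrC lerD// chain_le// (leq_maxl, leq_maxr).
Qed.

Lemma chain_inf_opp n : chain_inf (- u n) <= - chain n (u n).
Proof. exact: le_trans (chain_inf_le n.+1 _) (bend_opp _ (chain_sublinear n)). Qed.

(** Every [x] is some [u n], where the chain is bent at step [n.+1]. *)
Lemma chain_infN x : chain_inf (- x) = - chain_inf x.
Proof.
apply/eqP; rewrite eq_le; apply/andP; split.
  have [n <-] := u_surj x; apply: le_trans (chain_inf_opp n) _.
  by rewrite lerN2 chain_inf_le.
rewrite lerNl -subr_ge0 opprK addrC; apply: le_trans (chain_infD _ _).
by rewrite addNr; refine (le_chain_inf _) => n; rewrite (sublinear0 (chain_sublinear n)).
Qed.

Lemma chain_infB : GRing.zmod_morphism chain_inf.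
Proof.
move=> x y; apply/eqP; rewrite eq_le; apply/andP; split.
  by rewrite -(chain_infN y) chain_infD.
by rewrite lerBlDr; have := chain_infD (x - y) y; rewrite subrK.
Qed.

Lemma chain_inf_u n : chain_inf (u n) = chain n (u n).
Proof.
apply/eqP; rewrite eq_le chain_inf_le/= -lerN2 -chain_infN; exact: chain_inf_opp.
Qed.

(** By induction [a] and [b] lie below [chain n]. At [u n] their convex combination reaches this
    common upper bound, so both do, and both remain below the next bend. *)
Lemma chain_inf_extreme (a b : {additive G -> R}) t : 0 < t < 1 ->
    (forall x, a x <= q x) -> (forall x, b x <= q x) ->
    (forall x, chain_inf x = t * a x + (1 - t) * b x) ->
  a =1 chain_inf /\ b =1 chain_inf.
Proof.
move=> /andP[t0 t1] aq bq E.
have eq_u n : (forall x, a x <= chain n x) -> (forall x, b x <= chain n x) ->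
    a (u n) = chain n (u n) /\ b (u n) = chain n (u n).
  move=> ha hb; have := E (u n); rewrite chain_inf_u.
  have := ha (u n); have := hb (u n); nra.
have le_ab n : (forall x, a x <= chain n x) /\ (forall x, b x <= chain n x).
  elim: n => // n [ha hb]; have [Ea Eb] := eq_u n ha hb.
  by split=> x; apply: le_bend_additive.
by split=> x; have [n <-] := u_surj x; rewrite chain_inf_u;
  have [ha hb] := le_ab n; have [] := eq_u n ha hb.
Qed.

End Chain.

Lemma sublinear_extreme q g : countable [set: G] -> sublinear q ->
  exists tau : {additive G -> R}, [/\ forall x, tau x <= q x, tau g = q g &
    forall (a b : {additive G -> R}) t, 0 < t < 1 ->
      (forall x, a x <= q x) -> (forall x, b x <= q x) ->
      (forall x, tau x = t * a x + (1 - t) * b x) -> a =1 tau /\ b =1 tau].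
Proof.
move=> /countable_injP[f f_inj] qP.
(* Putting [g] first means that [q] itself is bent at [g], whence [tau g = q g]; indices outside the
   range of [f] default to 0. *)
pose u n := if n is k.+1 then xget 0 [set x | f x = k] else g.
have u_surj x : exists n, u n = x.
  by exists (f x).+1; apply: xget_unique => // y fxy; apply: f_inj; rewrite ?inE.
have [tau tauE] := zmod_morphism_additive (chain_infB qP u_surj).
exists tau; rewrite -tauE; split.
- exact: (chain_inf_le u qP 0).
- exact: (chain_inf_u qP u_surj 0).
- exact: chain_inf_extreme.
Qed.

End Sublinear.

(** * The gauge of the order unit and extremal states *)

Section Gauge.
Variables (R : realType) (G : zmodType) (P : set G) (e : G).
Hypotheses (oP : ordered_abelian_group P) (eP : order_unit P e).
Variable s : G -> R.
Hypothesis s_state : states R P e s.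

Lemma cone0 : P 0.
Proof. by have : [set 0 : G] 0 by []; rewrite -(oag_salient oP) => -[]. Qed.

Lemma coneMn x n : P x -> P (x *+ n).
Proof.
move=> Px; elim: n => [|n IHn]; first exact: cone0.
by rewrite mulrS; exact: oag_add.
Qed.

(** The numerator is an integer, so that the gauge can be negative. *)
Definition gauge_set x : set R :=
  [set r | exists k m, P (e *~ k - x *+ m.+1) /\ r = k%:~R / m.+1%:R].

Definition gauge x := inf (gauge_set x).

Lemma le_state_gauge_set a x r : states R P e a -> gauge_set x r -> a x <= r.
Proof.
move=> [[aB a0] a1] [k [m [Pkm ->]]].
have [F EF] := zmod_morphism_additive aB.
have : 0 <= a (e *~ k - x *+ m.+1) by apply: a0; exists (e *~ k - x *+ m.+1).
rewrite EF raddfB raddfMn raddfMz -EF a1 subr_ge0.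
by rewrite ler_pdivlMr ?ltr0Sn// mulr_natr.
Qed.

(** The state [s] bounds the set below, which makes [inf] a genuine infimum. *)
Lemma gauge_le x (r : R) : gauge_set x r -> gauge x <= r.
Proof.
move=> h; apply: ge_inf => //; exists (s x) => r'; exact: le_state_gauge_set.
Qed.

Lemma gauge_set_nonempty x : gauge_set x !=set0.
Proof.
have [_ /(_ x)[k [_ Pk]]] := eP; exists (k%:~R / 1), k, 0%N.
by rewrite mulr1n -pmulrn.
Qed.

Lemma le_gauge (c : R) x : (forall r, gauge_set x r -> c <= r) -> c <= gauge x.
Proof. by move=> h; apply: lb_le_inf => //; exact: gauge_set_nonempty. Qed.

Lemma state_le_gauge a x : states R P e a -> a x <= gauge x.
Proof. by move=> ha; refine (le_gauge _) => r; exact: le_state_gauge_set. Qed.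

Lemma gauge_sublinear : sublinear gauge.
Proof.
split=> [x y|x n].
  rewrite -lerBlDr; refine (le_gauge _) => r xr; rewrite lerBlDr -lerBlDl.
  refine (le_gauge _) => r' yr'; rewrite lerBlDr; apply: gauge_le.
  move: xr yr' => [k [m [Pkm ->]]] [k' [m' [Pkm' ->]]].
  (* Common denominator; the predecessor compensates the successor built into [gauge_set]. *)
  exists (k * m'.+1%:Z + k' * m.+1%:Z), (m.+1 * m'.+1).-1; rewrite prednK//; split.
    have := oag_add oP (coneMn m'.+1 Pkm) (coneMn m.+1 Pkm').
    congr P; rewrite !mulrnBl -!mulrnA mulrnDl mulrzDr !mulrzA -!pmulrn.
    by rewrite [(m'.+1 * _)%N]mulnC opprD addrACA.
  by rewrite intrD !intrM natrM addf_div ?pnatr_eq0// [X in X / _ = _]addrC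
    [m'.+1%:R * _]mulrC.
refine (le_gauge _) => r [k [m [Pkm ->]]]; case: n Pkm => [|n] Pkm.
  (* The zero multiple requires [0 <= k], obtained by applying [s] to [e *~ k]. *)
  rewrite mulr0n; apply: mulr_ge0; last by rewrite invr_ge0.
  have [[sB s0] s1] := s_state; have [F EF] := zmod_morphism_additive sB.
  have : 0 <= s (e *~ k - x *+ 0 *+ m.+1) by apply: s0; exists (e *~ k - x *+ 0 *+ m.+1).
  by rewrite mulr0n mul0rn subr0 EF raddfMz -EF s1.
rewrite -[leLHS]mulr_natr -ler_pdivlMr ?ltr0Sn//; apply: gauge_le.
exists k, (n.+1 * m.+1).-1; rewrite prednK// mulrnA; split => //.
by rewrite natrM invfM mulrA mulrAC.
Qed.

(** A negative bound of [- x] says that some [x *+ m.+1] dominates a positive multiple of [e]. *)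
Lemma gauge_lt0 x : gauge (- x) < 0 -> exists m, P (x *+ m.+1).
Proof.
move=> /(inf_lt (gauge_set_nonempty _))[r [k [m [Pkm ->]]] k0]; exists m.
move: Pkm; rewrite mulNrn opprK.
have {}k0 : k < 0.
  by move: k0; rewrite pmulr_llt0 ?invr_gt0 ?ltr0Sn// ltrz0.
case: k k0 => // k _; rewrite NegzE mulrNz -pmulrn => Pkm.
have := oag_add oP (coneMn k.+1 eP.1) Pkm.
by rewrite addNKr.
Qed.

(** Additive maps below the gauge are exactly the states: the gauge is at most 0 at [- y] for
    positive [y], at most 1 at [e] and at most -1 at [- e]. So extremeness below the gauge is
    extremeness among states. *)
Lemma extremal_gauge x :
  exists2 tau : G -> R, extremal_states R P e tau & tau x = gauge x.
Proof.
have [tau [tau_le taux tau_ext]] :=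
  sublinear_extreme x (oag_countable oP) gauge_sublinear.
exists tau => //; split; first split; first split.
- exact: raddfB.
- move=> _ [y Py <-]; rewrite /= -oppr_le0 -raddfN.
  apply: le_trans (tau_le _) _; apply: gauge_le; exists 0, 0%N.
  by rewrite mulr0z sub0r mulNrn opprK mulr1n mul0r.
- apply/eqP; rewrite eq_le; apply/andP; split.
    apply: le_trans (tau_le _) _; apply: gauge_le; exists 1, 0%N.
    by rewrite mulr1z mulr1n subrr divr1; split => //; exact: cone0.
  rewrite -lerN2 -raddfN; apply: le_trans (tau_le _) _.
  apply: gauge_le; exists (-1), 0%N.
  by rewrite mulrNz mulr1z mulr1n subrr divr1; split => //; exact: cone0.
- move=> a b t sa sb t01 E.
  have [F EF] := zmod_morphism_additive sa.1.1.
  have [H EH] := zmod_morphism_additive sb.1.1.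
  have [] := tau_ext F H t t01 _ _ _.
  + by move=> y; rewrite -EF; exact: state_le_gauge.
  + by move=> y; rewrite -EH; exact: state_le_gauge.
  + by move=> y; rewrite -EF -EH E.
  + by rewrite -EF -EH => /funext -> /funext ->.
Qed.

End Gauge.

(** * Order units from simplicity *)

(** The elements bounded on both sides by multiples of [g] form a non-zero order ideal, hence all of
    [G]. *)
Lemma simple_order_unit (G : zmodType) (P : set G) g a :
  simple_dimension_group P -> P g -> g <> 0 -> exists k, P (g *+ k - a).
Proof.
move=> [dP simple] Pg g0; have oP := dimension_group_ordered dP.
pose J : set G := [set x | exists k, P (g *+ k - x) /\ P (g *+ k + x)].
have gJ : J g.
  exists 1%N; rewrite mulr1n subrr; split; first exact: cone0.
  exact: (oag_add oP).
have JB x y : J x -> J y -> J (x - y).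
  move=> [k [k1 k2]] [l [l1 l2]]; exists (k + l)%N; rewrite mulrnDr; split.
    have := oag_add oP k1 l2; congr P.
    by rewrite opprB addrACA [- x + y]addrC.
  by have := oag_add oP k2 l1; congr P; rewrite addrACA.
have J0 : J 0 by rewrite -(subrr g); exact: JB.
have idealJ : order_ideal P J.
  split=> // [x [k [k1 k2]]|x y Px Pyx [k [k1 k2]]].
    exists (g *+ k), (g *+ k - x); rewrite subKr.
    have Jgk : J (g *+ k).
      exists k; rewrite subrr; split; first exact: cone0.
      by apply: (oag_add oP); exact: coneMn.
    split=> //; split=> //; [exact: coneMn | apply: JB => //; by exists k].
  exists k; split; last by apply: (oag_add oP) => //; exact: coneMn.
  by have := oag_add oP k1 Pyx; congr P; rewrite addrA subrK.
have [J1|JT] := simple _ idealJ; first by move: gJ; rewrite J1.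
have [k [Pk _]] : J a by rewrite JT.
by exists k.
Qed.

(** * Density of the pairs of values *)

Section TwoStates.
Variables (R : realType) (G : zmodType) (P : set G).
Hypothesis riesz : forall a1 a2 b1 b2,
  P (b1 - a1) -> P (b2 - a1) -> P (b1 - a2) -> P (b2 - a2) ->
  exists z, [/\ P (z - a1), P (z - a2), P (b1 - z) & P (b2 - z)].

Definition strict_cone (s1 s2 : G -> R) :=
  forall g, P g <-> g = 0 \/ 0 < s1 g /\ 0 < s2 g.

(** The factor 2 makes [M] exceed every difference of two of the values. *)
Lemma exists_natr_gt (r : seq R) :
  exists M : nat, forall x, x \in r -> `|x| *+ 2 < M%:R.
Proof.
elim: r => [|x r [M hM]]; first by exists 0%N.
exists (M + Num.bound (`|x| *+ 2))%N => y; rewrite inE natrD => /predU1P[->|yr].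
  have := archi_boundP (mulrn_wge0 2 (normr_ge0 x)).
  by move=> /lt_le_trans; apply; rewrite lerDr.
by apply: lt_le_trans (hM _ yr) _; rewrite lerDl.
Qed.

(* Interpolating between [g1 - M u2], [g2 - M u1] and [h1 + M u2], [h2 + M u1]
   for large [M] decouples the two coordinates. *)
Lemma riesz_box (s1 s2 : {additive G -> R}) u1 u2 g1 g2 h1 h2 :
  strict_cone s1 s2 -> s1 u1 = 1 -> s2 u2 = 1 -> s1 u2 = 0 -> s2 u1 = 0 ->
  s1 g1 < s1 h1 -> s2 g2 < s2 h2 ->
  exists z, s1 g1 < s1 z < s1 h1 /\ s2 g2 < s2 z < s2 h2.
Proof.
move=> PE s11 s22 s12 s21 gh1 gh2.
have [M hM] := exists_natr_gt
  [:: s1 g1; s1 g2; s1 h1; s1 h2; s2 g1; s2 g2; s2 h1; s2 h2].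
have bnd x : x \in [:: s1 g1; s1 g2; s1 h1; s1 h2; s2 g1; s2 g2; s2 h1; s2 h2] ->
    - M%:R < x *+ 2 < M%:R.
  by move=> /hM; rewrite -normrMn ltr_norml.
have := bnd (s1 g1); have := bnd (s1 g2); have := bnd (s1 h1); have := bnd (s1 h2).
have := bnd (s2 g1); have := bnd (s2 g2); have := bnd (s2 h1); have := bnd (s2 h2).
rewrite !inE !eqxx !orbT => /(_ isT)B1 /(_ isT)B2 /(_ isT)B3 /(_ isT)B4
  /(_ isT)B5 /(_ isT)B6 /(_ isT)B7 /(_ isT)B8.
have sE := (raddfB s1, raddfB s2, raddfD s1, raddfD s2, raddfMn s1, raddfMn s2,
  s11, s12, s21, s22, mul0rn).
have pos x : 0 < s1 x -> 0 < s2 x -> P x by move=> x1 x2; apply/PE; right.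
have [||||z [z1 z2 z3 z4]] := @riesz (g1 - u2 *+ M) (g2 - u1 *+ M)
    (h1 + u2 *+ M) (h2 + u1 *+ M).
- by apply: pos; rewrite !sE; lra.
- by apply: pos; rewrite !sE; lra.
- by apply: pos; rewrite !sE; lra.
- by apply: pos; rewrite !sE; lra.
have le x : P x -> 0 <= s1 x /\ 0 <= s2 x.
  by move=> /PE[->|[/ltW ? /ltW ?]] //; rewrite !raddf0.
exists z; split; apply/andP; split.
(* If the difference vanished, [s2 z] would be [s2 g1 - M], below the bound [s2 g2] given by [z2].
   The other three cases are alike. *)
- have := le _ z2; case/PE: z1 => [/subr0_eq ->|[]];
    rewrite !sE; lra.
- have := le _ z4; case/PE: z3 => [/subr0_eq <-|[]];
    rewrite !sE; lra.
- have := le _ z1; case/PE: z2 => [/subr0_eq ->|[]];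
    rewrite !sE; lra.
- have := le _ z3; case/PE: z4 => [/subr0_eq <-|[]];
    rewrite !sE; lra.
Qed.

Lemma dense_coordinate (s1 s2 : {additive G -> R}) u1 u2 (a b : R) :
  strict_cone s1 s2 -> s1 u1 = 1 -> s2 u2 = 1 -> s1 u2 = 0 -> s2 u1 = 0 ->
  a < b -> exists g, a < s1 g < b.
Proof.
move=> PE s11 s22 s12 s21 ab.
have small n : exists c, 0 < s1 c <= 2%:R ^- n.
  elim: n => [|n [v /andP[v0 vn]]].
    by exists u1; rewrite s11 ltr01 expr0 invr1 lexx.
  (* Only the first coordinate matters; [u2] merely supplies a non-empty interval in the second. *)
  have [||c [/andP[c0 cv] _]] := riesz_box (g1 := 0) (g2 := 0) (h1 := v)
    (h2 := u2) PE s11 s22 s12 s21.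
  - by rewrite raddf0.
  - by rewrite raddf0 s22.
  rewrite raddf0 in c0; rewrite exprS invfM.
  have [cv2|cv2] := leP (s1 c) (s1 v / 2%:R).
    by exists c; rewrite c0; lra.
  by exists (v - c); rewrite raddfB; apply/andP; split; lra.
have [n hn] : exists n, 2%:R ^- n < b - a :> R.
  have ba : 0 < b - a by rewrite subr_gt0.
  exists (Num.bound (b - a)^-1).
  rewrite invf_plt ?posrE ?exprn_gt0//.
  apply: lt_le_trans (archi_boundP _) _; first by rewrite invr_ge0 ltW.
  by rewrite -natrX ler_nat ltnW// ltn_expl.
have [c /andP[c0 cn]] := small n.
(* The first multiple of [s1 c] beyond [a] is below [b], since the mesh is smaller than [b - a]. *)
exists (c *~ (Num.floor (a / s1 c) + 1)); rewrite raddfMz -mulrzl.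
have := Num.Theory.floor_itv (a / s1 c).
rewrite ler_pdivlMr// ltr_pdivrMr// => /andP[h1 h2]; rewrite h2/=.
rewrite intrD mulrDl mul1r; lra.
Qed.

(** Each coordinate takes values on either side of the centre within the radius; [riesz_box] fills
    the box that they bound. *)
Lemma dense_two_states (s1 s2 : {additive G -> R}) u1 u2 :
  strict_cone s1 s2 -> s1 u1 = 1 -> s2 u2 = 1 -> s1 u2 = 0 -> s2 u1 = 0 ->
  dense (range (fun g => (s1 g, s2 g) : R * R)).
Proof.
move=> PE s11 s22 s12 s21 O [[x y] Oxy] openO.
have /nbhs_ballP[r /= r0 rO] : nbhs (x, y) O by exact: open_nbhs_nbhs.
have PE' : strict_cone s2 s1 by move=> g; rewrite PE andC.
have mid (t : R) : t - r < t /\ t < t + r by lra.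
have [g1 /andP[xg1 g1x]] := dense_coordinate PE s11 s22 s12 s21 (mid x).1.
have [h1 /andP[xh1 h1x]] := dense_coordinate PE s11 s22 s12 s21 (mid x).2.
have [g2 /andP[yg2 g2y]] := dense_coordinate PE' s22 s11 s21 s12 (mid y).1.
have [h2 /andP[yh2 h2y]] := dense_coordinate PE' s22 s11 s21 s12 (mid y).2.
have [z [/andP[z1 z2] /andP[z3 z4]]] := riesz_box PE s11 s22 s12 s21
  (lt_trans g1x xh1) (lt_trans g2y yh2).
exists (s1 z, s2 z); split; last by exists z.
by apply: rO; split; rewrite /= /ball/= ltr_norml; apply/andP; split; lra.
Qed.

End TwoStates.

(** * The positive cone, the integer points and density *)

Theorem theorem1p2 (R : realType) (G : zmodType) (P : set G) (e : G)
    (hG : simple_dimension_group P) (he : order_unit P e)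
    (sigma1 sigma2 : G -> R) (hne : sigma1 <> sigma2)
    (hext : extremal_states R P e = [set sigma1; sigma2])
    (u1 u2 : G)
    (h11 : sigma1 u1 = 1) (h22 : sigma2 u2 = 1)
    (h12 : sigma1 u2 = 0) (h21 : sigma2 u1 = 0) :
  let sigma : G -> R * R := fun g => (sigma1 g, sigma2 g) in
  [/\ P = [set 0] `|` sigma @^-1` (`]0, +oo[ `*` `]0, +oo[),
      [set ((m%:~R : R), (n%:~R : R)) | m in [set: int] & n in [set: int]]
        `<=` range sigma &
      dense (range sigma)].
Proof.
move=> sigma; have [dP _] := hG; have oP := dimension_group_ordered dP.
have ext1 : extremal_states R P e sigma1 by rewrite hext; left.
have ext2 : extremal_states R P e sigma2 by rewrite hext; right.
have pos s g : states R P e s -> P g -> g <> 0 -> 0 < s g.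
  move=> [[sB s0] s1] Pg g0.
  (* A multiple of [g] dominates [e], so [1 <= s g *+ k], which also excludes [k = 0]. *)
  have [k Pk] := simple_order_unit e hG Pg g0.
  have [F EF] := zmod_morphism_additive sB.
  have : 0 <= s (g *+ k - e) by apply: s0; exists (g *+ k - e).
  rewrite EF raddfB raddfMn -EF s1 subr_ge0; case: k {Pk} => [|k] sk.
    by move: sk; rewrite mulr0n ler10.
  by rewrite -(pmulrn_lgt0 _ (ltn0Sn k)) (lt_le_trans ltr01).
have PE : strict_cone P sigma1 sigma2.
  move=> g; split=> [Pg|[->|[g1 g2]]]; last 2 first.
  - exact: cone0.
  - have [tau] := extremal_gauge oP he ext1.1 (- g).
    have [F1 EF1] := zmod_morphism_additive ext1.1.1.1.
    have [F2 EF2] := zmod_morphism_additive ext2.1.1.1.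
    rewrite hext => tauE tau_g.
    have : gauge R P e (- g) < 0.
      by rewrite -tau_g; case: tauE => ->; rewrite ?EF1 ?EF2 raddfN oppr_lt0 -?EF1 -?EF2.
    move=> /(gauge_lt0 oP he)[m]; exact: dimension_group_unperforated.
  have [->|/eqP g0] := eqVneq g 0; [by left | right].
  by split; apply: pos => //; [exact: ext1.1 | exact: ext2.1].
have [s1 Es1] := zmod_morphism_additive ext1.1.1.1.
have [s2 Es2] := zmod_morphism_additive ext2.1.1.1.
subst sigma1 sigma2; split.
- apply/seteqP; split=> g.
    move=> /PE[->|[g1 g2]]; [by left | right].
    by split; rewrite /= in_itv/= andbT.
  move=> [->|[/=]]; first exact: cone0.
  by rewrite !in_itv/= !andbT => g1 g2; apply/PE; right.
- move=> _ [m _ [n _ <-]]; exists (u1 *~ m + u2 *~ n) => //.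
  by rewrite /sigma !raddfD !raddfMz h11 h22 h12 h21 !mul0rz addr0 add0r.
- exact: (dense_two_states (dimension_group_riesz dP) PE h11 h22 h12 h21).
Qed.
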